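(* Let $m\in\mathbb{N}\setminus\{0\}$ and $p\in(\mathbb{N}\setminus\{0\})\cup\{\infty\}$. Let $f\colon\mathbb{R}^m\to\mathbb{R}$ be continuous and piecewise-$C^p$, and let $(\{P^j\}_{j=1}^J,\{f^j\}_{j=1}^J)$ be a representation of $f$. Let $$D_f(x)\coloneqq\{\nabla f^j(x): j\in\{1,\ldots,J\},\ x\in\operatorname{cl}P^j\},\qquad x\in\mathbb{R}^m.$$ Then $D_f$ is a conservative field for $f$; that is (in addition to $D_f$ being locally bounded and graph-closed with nonempty values), for any Lipschitz continuous curve $v\colon[0,1]\to\mathbb{R}^m$, for almost all $t\in[0,1]$, $$\frac{d}{dt}f(v(t))=\langle\dot v(t),u\rangle\qquad\forall u\in D_f(v(t)).$$ In particular, $f$ is path differentiable, and the set-valued maps $x\mapsto\operatorname{conv}D_f(x)$ and $x\mapsto\partial^c f(x)$ (the Clarke subdifferential) are conservative fields for $f$.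
   Context: A continuous function $f\colon\mathbb{R}^m\to\mathbb{R}$ is piecewise-$C^p$ if there exist a finite Borel partition $\mathbb{R}^m=\bigsqcup_{j=1}^J P^j$ (nonempty, pairwise disjoint Borel sets) and $C^p$ functions $f^1,\ldots,f^J\colon\mathbb{R}^m\to\mathbb{R}$ such that $f(x)=f^j(x)$ whenever $x\in P^j$. The pair $(\{P^j\}_{j=1}^J,\{f^j\}_{j=1}^J)$ is called a representation of $f$. Every such function is locally Lipschitz. A set-valued map $D\colon\mathbb{R}^m\rightrightarrows\mathbb{R}^m$ is locally bounded if every point $x$ has a neighborhood $\mathcal N$ such that $\bigcup_{z\in\mathcal N}D(z)$ is bounded; it is graph-closed if $\{(x,y): y\in D(x)\}$ is closed in $\mathbb{R}^m\times\mathbb{R}^m$. Let $\varphi\colon\mathbb{R}^m\to\mathbb{R}$ be locally Lipschitz. A conservative field for $\varphi$ is a locally bounded, graph-closed set-valued map $D_\varphi\colon\mathbb{R}^m\rightrightarrows\mathbb{R}^m$ with nonempty values such that for every Lipschitz curve $v\colon[0,1]\to\mathbb{R}^m$, for almost all $t\in[0,1]$, $\frac{d}{dt}\varphi(v(t))=\langle\dot v(t),u\rangle$ for all $u\in D_\varphi(v(t))$. A locally Lipschitz function admitting a conservative field is called path differentiable. The Clarke subdifferential of $\varphi$ is $\partial^c\varphi(x)=\operatorname{conv}\{u: \exists (x_\ell)\subset\Omega_\varphi,\ x_\ell\to x,\ \nabla\varphi(x_\ell)\to u\}$, where $\Omega_\varphi$ is the (full-measure) set of points of differentiability of $\varphi$.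 Here $\operatorname{conv}$ denotes the convex hull, $\operatorname{cl}$ the closure, and ''almost all'' refers to Lebesgue measure. *)

(* Defs.v *)
From HB Require Import structures.
From mathcomp Require Export all_boot all_order all_algebra.
From mathcomp Require Export all_classical all_reals all_analysis.

Set Implicit Arguments.
Unset Strict Implicit.
Unset Printing Implicit Defensive.

Import Order.TTheory GRing.Theory Num.Theory.
Import numFieldNormedType.Exports.
Export numFieldNormedType.Exports.

Local Open Scope classical_set_scope.
Local Open Scope ring_scope.

(* R^m is 'rV[R]_m.  Its library norm is the max norm; the notions below that
   mention a norm (boundedness, Lipschitz continuity) do not depend on the
   choice of norm in finite dimension. *)

Section defs.
Context {R : realType} {m : nat}.
Implicit Types (f phi : 'rV[R]_m -> R) (x u w : 'rV[R]_m).
Implicit Types (D : 'rV[R]_m -> set 'rV[R]_m).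

Definition dot u w : R := \sum_(i < m) u ord0 i * w ord0 i.

Definition partial (i : 'I_m) f : 'rV[R]_m -> R :=
  fun x => 'D_(delta_mx ord0 i) f x.

(* Represents the Frechet differential only at points where f is differentiable. *)
Definition gradient f x : 'rV[R]_m := \row_(i < m) partial i f x.

Fixpoint is_Cn (n : nat) f : Prop :=
  if n is k.+1 then
    (forall x, differentiable f x) /\ (forall i, is_Cn k (partial i f))
  else continuous f.

(* Smoothness orders: [Some n] is n, [None] is infinity. *)
Definition is_C (p : option nat) f : Prop :=
  if p is Some n then is_Cn n f else forall n, is_Cn n f.

Definition borel (A : set 'rV[R]_m) : Prop := <<s [set U | open U] >> A.

Definition borel_partition (J : nat) (P : 'I_J -> set 'rV[R]_m) : Prop :=
  [/\ forall j, borel (P j),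
      forall j, P j !=set0,
      trivIset setT P &
      \bigcup_j P j = setT].

Definition representation (p : option nat) f (J : nat)
    (P : 'I_J -> set 'rV[R]_m) (g : 'I_J -> 'rV[R]_m -> R) : Prop :=
  [/\ borel_partition P,
      forall j, is_C p (g j) &
      forall j x, P j x -> f x = g j x].

Definition piecewise_C (p : option nat) f : Prop :=
  continuous f /\ exists J (P : 'I_J -> set 'rV[R]_m) g, representation p f P g.

Definition locally_bounded D : Prop :=
  forall x, exists2 N, nbhs x N & bounded_set (\bigcup_(z in N) D z).

Definition graph_closed D : Prop :=
  closed [set z : 'rV[R]_m * 'rV[R]_m | D z.1 z.2].

Definition locally_lipschitz phi : Prop :=
  forall x, exists2 N, nbhs x N & [lipschitz phi z | z in N].

(* A curve on [0, 1] is represented by a function on R of which only the values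
   on [0, 1] are constrained.  The two-sided derivatives depend on the values
   outside [0, 1] only at the endpoints t = 0 and t = 1, a null set. *)
Definition chain_rule phi D : Prop :=
  forall v : R -> 'rV[R]_m, [lipschitz v t | t in `[0, 1]] ->
  {ae (@lebesgue_measure R), forall t : R, t \in `[0, 1] ->
    [/\ derivable v t 1,
        derivable (phi \o v) t 1 &
        forall u, D (v t) u -> derive1 (phi \o v) t = dot (derive1 v t) u]}.

Definition conservative_field phi D : Prop :=
  [/\ locally_bounded D, graph_closed D, forall x, D x !=set0 &
      chain_rule phi D].

Definition path_differentiable phi : Prop :=
  locally_lipschitz phi /\ exists D, conservative_field phi D.

Definition conv (A : set 'rV[R]_m) : set 'rV[R]_m :=
  smallest (@convex_set R 'rV[R]_m) A.

Definition limiting_gradients phi x : set 'rV[R]_m :=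
  [set u | exists xs : nat -> 'rV[R]_m,
    [/\ forall l, differentiable phi (xs l),
        xs l @[l --> \oo] --> x &
        gradient phi (xs l) @[l --> \oo] --> u]].

Definition clarke phi x : set 'rV[R]_m := conv (limiting_gradients phi x).

Definition piece_field (J : nat) (P : 'I_J -> set 'rV[R]_m)
    (g : 'I_J -> 'rV[R]_m -> R) x : set 'rV[R]_m :=
  [set u | exists2 j, closure (P j) x & u = gradient (g j) x].

End defs.

(* Main.v *)
(** The closures [E j] of the pieces form a finite closed cover on which [f = g j].
Along a Lipschitz curve [v], almost every time [t] is a point of differentiability
of [v] and an isolated point of none of the sets [{s | v s \in E j /\ v s \in E k}],
since such points are countable.  At such a [t] the derivatives of [g j \o v] over
the active [j] all agree, two of these functions coinciding on a set that
accumulates at [t]; this common value is then the derivative of [f \o v].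

The convex hulls keep a closed graph because the weights range over a compact
simplex.  For the Clarke subdifferential, replacing [E j] by the closure of its
interior still gives a closed cover, and the limiting gradients of [f] are exactly
the gradients [gradient (g j) x] that are active for this smaller cover. *)

From HB Require Import structures.
Require Import Defs.
From mathcomp Require Import lra ring.

Set Implicit Arguments.
Unset Strict Implicit.
Unset Printing Implicit Defensive.

Import Order.TTheory GRing.Theory Num.Theory.
Local Open Scope classical_set_scope.
Local Open Scope ring_scope.

(** * Stieltjes measures and almost everywhere differentiability of Lipschitz functions *)

Lemma lebesgue_stieltjes_measure_ocitv (R : realType) (F : cumulative R R)
    (a b : R) :
  a <= b -> lebesgue_stieltjes_measure F `]a, b] = (F b - F a)%:E.
Proof.
move=> ab; rewrite /lebesgue_stieltjes_measure/measure_extension.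
rewrite measurable_mu_extE/=; last exact: is_ocitv.
by rewrite wlength_itv_bnd.
Qed.

(** The measure of [F + G] is both the sum of the two Stieltjes measures and [k] times Lebesgue
    measure, by uniqueness from the values on half-open intervals; dropping the nonnegative measure
    of [G] leaves the bound. *)
Lemma lebesgue_stieltjes_measure_le (R : realType) (F G : cumulative R R)
    (k : {nonneg R}) :
  (forall t, F t + G t = k%:num * t) ->
  forall A, measurable A ->
  (lebesgue_stieltjes_measure F A <= k%:num%:E * lebesgue_measure A)%E.
Proof.
move=> FG A mA.
pose H := fun t : R => F t + G t.
have Hnd : nondecreasing H.
  by move=> x y xy; rewrite /H lerD// cumulative_is_nondecreasing.
have Hrc : right_continuous H.
  by move=> x; apply: cvgD; exact: cumulative_is_right_continuous.
pose HC : cumulative R R := HB.pack_for (cumulative R R) H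
  (isCumulative.Build R _ R H Hnd Hrc).
have E1 : lebesgue_stieltjes_measure HC A =
    measure_add (lebesgue_stieltjes_measure F) (lebesgue_stieltjes_measure G) A.
  apply: lebesgue_stieltjes_measure_unique => // X /ocitvP[->|[[a b]/= /ltW ab ->]].
    by rewrite !measure0.
  rewrite /msum !big_ord_recl big_ord0 adde0/=.
  rewrite !lebesgue_stieltjes_measure_ocitv// -EFinD/=; congr EFin.
  by rewrite /H; ring.
have E2 : lebesgue_stieltjes_measure HC A = mscale k lebesgue_measure A.
  apply: lebesgue_stieltjes_measure_unique => // X /ocitvP[->|[[a b]/= /ltW ab ->]].
    by rewrite !measure0.
  rewrite /mscale/= /lebesgue_measure.
  rewrite !lebesgue_stieltjes_measure_ocitv// -EFinM/=; congr EFin.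
  by rewrite /H !FG; ring.
have -> : (k%:num%:E * lebesgue_measure A)%E = mscale k lebesgue_measure A by [].
rewrite -E2 E1 measure_addE; exact: leeDl.
Qed.

Lemma continuous_of_dist_le (R : realType) (F : R -> R) (k : R) :
  (forall x y, `|F x - F y| <= k * `|x - y|) -> continuous F.
Proof.
move=> Fk x; apply/cvgrPdist_le => e e0.
have k1 : 0 < `|k| + 1 by rewrite ltr_wpDl.
near=> y; apply: le_trans (Fk _ _) _.
apply: (@le_trans _ _ ((`|k| + 1) * `|x - y|)).
  by rewrite ler_wpM2r// (le_trans (ler_norm _))// lerDl.
rewrite -ler_pdivlMl//; near: y.
by apply: cvgr_dist_le; [exact: cvg_id|rewrite mulr_gt0// invr_gt0].
Unshelve. all: by end_near. Qed.

(* Extended by constants, [v] plus or minus [`|k| * t] is nondecreasing, so the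
   Stieltjes measure of [v + `|k| * t] is dominated by Lebesgue measure and has a
   density, to which the Lebesgue differentiation theorem applies. *)
Lemma lipschitz_ae_derivable (R : realType) (k a b : R) (v : R -> R) :
  k.-lipschitz_`[a, b] v ->
  {ae (@lebesgue_measure R), forall t, t \in `]a, b[ -> derivable v t 1}.
Proof.
move=> kv.
have [ab|ba] := ltP a b; last first.
  apply: aeW => t; rewrite in_itv/= => /andP[ta tb].
  by have := lt_trans ta tb; rewrite ltNge ba.
(* The retraction of the line onto [[a, b]]; it is 1-Lipschitz, so [v \o c] keeps a Lipschitz
   bound. *)
pose c (t : R) := Num.max a (Num.min t b).
have cab t : c t \in `[a, b].
  by rewrite in_itv/= /c; case: (leP t b) => tb;
    [case: (leP a t)|case: (leP a b)]; lra.
have cE t : t \in `[a, b] -> c t = t.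
  by rewrite in_itv/= /c => /andP[? ?]; rewrite min_l// max_r.
have c1 x y : `|c x - c y| <= `|x - y|.
  rewrite /c; case: (leP x b) => ?; case: (leP y b) => ?;
    case: (leP a x) => ?; case: (leP a y) => ?; case: (leP a b) => ?;
    rewrite ler_norml; have := ler_norm (x - y);
    have := ler_norm (- (x - y)); rewrite normrN; lra.
pose w t := v (c t).
have wk x y : `|w x - w y| <= `|k| * `|x - y|.
  apply: (@le_trans _ _ (k * `|c x - c y|)).
    by apply: (kv (c x, c y)); split; exact: cab.
  apply: (@le_trans _ _ (`|k| * `|c x - c y|)); last by rewrite ler_wpM2l.
  by rewrite ler_wpM2r// ler_norm.
have wc := continuous_of_dist_le wk.
pose F t := w t + `|k| * t; pose G t := `|k| * t - w t.
have idc (x : R) : (fun t : R => `|k| * t) @ x --> `|k| * x.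
  by apply: cvgM; [exact: cvg_cst|exact: cvg_id].
have Fnd : {homo F : x y / x <= y}.
  move=> x y xy; rewrite /F; have := wk x y.
  rewrite ler_norml (@ler0_norm _ (x - y)) ?subr_le0// => /andP[]; lra.
have Gnd : {homo G : x y / x <= y}.
  move=> x y xy; rewrite /G; have := wk x y.
  rewrite ler_norml (@ler0_norm _ (x - y)) ?subr_le0// => /andP[]; lra.
have Frc : right_continuous F.
  by apply: right_continuousW => x; apply: cvgD; [exact: wc|exact: idc].
have Grc : right_continuous G.
  by apply: right_continuousW => x; apply: cvgB; [exact: idc|exact: wc].
pose FC : cumulative R R := HB.pack_for (cumulative R R) F
  (isCumulative.Build R _ R F Fnd Frc).
pose GC : cumulative R R := HB.pack_for (cumulative R R) G
  (isCumulative.Build R _ R G Gnd Grc).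
have le := @lebesgue_stieltjes_measure_le R FC GC (`|k| + `|k|)%:nng.
have {}le : forall A, measurable A ->
    (lebesgue_stieltjes_measure FC A <= (`|k| + `|k|)%:E * lebesgue_measure A)%E.
  by apply: le => t /=; rewrite /F /G; ring.
have mab : measurable (`]a, b]%classic : set (measurableTypeR R)).
  by apply: sub_sigma_algebra; exact: is_ocitv.
have fab : (lebesgue_stieltjes_measure FC `]a, b] < +oo)%E.
  by rewrite lebesgue_stieltjes_measure_ocitv ?ltry// ltW.
(* Restricting to []a, b]] makes the measure finite, as the Radon-Nikodym theorem requires. *)
pose nu : {finite_measure set _ -> \bar R} := mfrestr mab fab.
have numu : nu `<< @lebesgue_measure R.
  apply/null_content_dominatesP => A mA A0.
  apply/eqP; rewrite eq_le measure_ge0 andbT.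
  apply: le_trans (le _ (measurableI _ _ mA mab)) _.
  rewrite (_ : lebesgue_measure _ = 0) ?mule0//.
  apply: subset_measure0 A0 => //; exact: measurableI.
have [f [f0 ffin fint nuE]] := radon_nikodym_sigma_finite numu.
have fE : EFin \o (fine \o f) = f by apply/funext => x; rewrite /= fineK.
have fint' : (@lebesgue_measure R).-integrable setT (EFin \o (fine \o f)).
  by rewrite fE.
have := @FTC1 R (fine \o f) (BRight a).
have fl : locally_integrable [set: R] (fine \o f).
  by apply: open_integrable_locally => //; exact: openT.
move=> /(_ _ fl); case.
  by move=> y; apply: integrableS fint'.
move=> N [mN N0 NH]; exists N; split => // t /= tN; apply: NH => /= tH.
apply: tN; rewrite in_itv/= => /andP[ta tb].
have /= [+ _] := tH ta.
set H := (X in derivable X).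
have nuitvE x : (\int[lebesgue_measure]_(t in `]a, x]) f t)%E = nu `]a, x]%classic.
  by rewrite nuE//; apply: sub_sigma_algebra; exact: is_ocitv.
(* [H x] is the Stieltjes mass of []a, x]], that is [F x - F a], so [v] differs from [H] by an
   affine function on []a, b[] and inherits its derivability. *)
have HE x : x \in `]a, b[ -> H x - `|k| * x + F a = v x.
  rewrite in_itv/= => /andP[ax xb].
  rewrite /H /Rintegral -/(EFin \o (fine \o f)) fE nuitvE.
  rewrite /nu/= /mfrestr/= /mrestr setIidl; last first.
    by apply: subset_itvl; rewrite bnd_simp ltW.
  rewrite lebesgue_stieltjes_measure_ocitv/= ?(ltW ax)// /F /w.
  rewrite (cE x) ?in_itv/= ?(ltW ax) ?(ltW xb)//; ring.
move=> dH.
apply: (@near_eq_derivable _ _ _ (fun x => H x - `|k| * x + F a)).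
  near=> x; apply: HE; near: x; apply: near_in_itvoo; by rewrite in_itv/= ta tb.
apply: derivableD; last exact: derivable_cst.
apply: derivableB => //; exact: derivableM.
Unshelve. all: by end_near. Qed.

(** * Coordinatewise limits, the dot product and gradients *)

Lemma cvg_bigsum (R : numFieldType) (V : normedModType R) (T I : Type)
    (F : set_system T) {FF : Filter F} (r : seq I) (h : I -> T -> V) (l : I -> V) :
  (forall i, h i @ F --> l i) ->
  (\sum_(i <- r) h i x) @[x --> F] --> \sum_(i <- r) l i.
Proof.
move=> hl; elim: r => [|i r IHr].
  by rewrite big_nil; under eq_cvg do rewrite big_nil; exact: cvg_cst.
by rewrite big_cons; under eq_cvg do rewrite big_cons; exact: cvgD.
Qed.

Lemma cvg_row (R : realType) (m : nat) (T : Type) (F : set_system T)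
    {FF : Filter F} (h : T -> 'rV[R]_m) (l : 'rV[R]_m) :
  (forall i, h x ord0 i @[x --> F] --> l ord0 i) -> h @ F --> l.
Proof.
move=> hl A [P lP PA].
have : F (fun x => forall i, P ord0 i (h x ord0 i)).
  by apply: filter_forall => i; apply: hl; exact: lP.
by apply: (@filterS _ F) => x Px; apply: PA => i j; rewrite (ord1 i).
Qed.

Lemma coord_le_norm (R : realType) (m : nat) (u : 'rV[R]_m) i :
  `|u ord0 i| <= `|u|.
Proof.
by rewrite [leRHS]/Num.Def.normr/= mx_normrE; exact: (le_bigmax _ _ (ord0, i)).
Qed.

Section dot.
Context {R : realType} {m : nat}.
Implicit Types u w : 'rV[R]_m.

Lemma dotDr w u u' : dot w (u + u') = dot w u + dot w u'.
Proof. by rewrite -big_split; apply: eq_bigr => i _; rewrite mxE mulrDr. Qed.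

Lemma dotZr w a u : dot w (a *: u) = a * dot w u.
Proof. by rewrite mulr_sumr; apply: eq_bigr => i _; rewrite mxE mulrCA. Qed.

Lemma dotBr w u u' : dot w (u - u') = dot w u - dot w u'.
Proof. by rewrite dotDr -scaleN1r dotZr mulN1r. Qed.

Lemma dotDl w w' u : dot (w + w') u = dot w u + dot w' u.
Proof. by rewrite -big_split; apply: eq_bigr => i _; rewrite mxE mulrDl. Qed.

Lemma dotZl a w u : dot (a *: w) u = a * dot w u.
Proof. by rewrite mulr_sumr; apply: eq_bigr => i _; rewrite mxE mulrA. Qed.

Lemma dot_delta i u : dot (delta_mx ord0 i) u = u ord0 i.
Proof.
rewrite /dot (bigD1 i)//= mxE !eqxx mul1r big1 ?addr0// => j ji.
by rewrite mxE (negbTE ji) andbF mul0r.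
Qed.

(** A substitute for Cauchy-Schwarz: the norm is the max norm, so each of the [m] terms is at most
    the product of the norms. *)
Lemma ler_norm_dot w u : `|dot w u| <= m%:R * `|u| * `|w|.
Proof.
apply: le_trans (ler_norm_sum _ _ _) _.
rewrite -mulrA mulr_natl -[X in _ *+ X]card_ord -sumr_const.
by apply: ler_sum => i _; rewrite normrM mulrC ler_pM// coord_le_norm.
Qed.

Lemma continuous_dot u : continuous (dot^~ u).
Proof.
move=> w; rewrite /dot; apply: (@cvg_bigsum _ R^o _ _ (nbhs w)) => i.
by apply: cvgM; [exact: coord_continuous|exact: cvg_cst].
Qed.

End dot.

Section gradient.
Context {R : realType} {m : nat}.
Implicit Types h : 'rV[R]_m -> R.

Lemma diff_dot_gradient h x w :
  differentiable h x -> 'd h x w = dot w (gradient h x).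
Proof.
move=> dh; rewrite {1}(row_sum_delta w) linear_sum; apply: eq_bigr => i _.
by rewrite linearZ/= mxE /partial deriveE.
Qed.

Lemma derive1_comp_gradient h (v : R -> 'rV[R]_m) t :
  derivable v t 1 -> differentiable h (v t) ->
  derivable (h \o v) t 1 /\
  derive1 (h \o v) t = dot (derive1 v t) (gradient h (v t)).
Proof.
move=> /derivable1_diffP dv dh.
have dhv : differentiable (h \o v) t by exact: differentiable_comp.
split; first exact/derivable1_diffP.
by rewrite derive1E'// diff_comp//= -derive1E'// diff_dot_gradient.
Qed.

(** The differential contributes [k] and the little-o remainder the extra [1]. Only increments based
    at [x] itself are controlled. *)
Lemma differentiable_dist_le h x (k : R) :
  differentiable h x -> m%:R * `|gradient h x| <= k ->
  \forall z \near x, `|h z - h x| <= (k + 1) * `|z - x|.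
Proof.
move=> dh hk.
have /diff_locally/eqaddoP/(_ 1 ltr01) H := dh.
rewrite (near_shift 0) subr0; move: H; apply: filterS => z /=.
rewrite /= !fctE /= mul1r addrK => H.
rewrite -[h _ - h x](subrK ('d h x z)).
rewrite (le_trans (ler_normD _ _))// mulrDl mul1r addrC lerD//.
  rewrite diff_dot_gradient// (le_trans (ler_norm_dot _ _))// ler_wpM2r//.
by move: H; rewrite opprD addrA.
Qed.

End gradient.

(** A continuous induction: the set of times up to which the increment from [0] obeys the bound
    contains its supremum, which cannot be less than [1]. *)
Lemma locally_dist_le_segment (R : realType) (phi : R -> R) (k : R) :
  (forall t : R, t \in `[0, 1] ->
    \forall s \near t, `|phi s - phi t| <= k * `|s - t|) ->
  `|phi 1 - phi 0| <= k.
Proof.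
move=> H.
pose A := [set t : R | t \in `[0, 1] /\ `|phi t - phi 0| <= k * t].
have A0 : A 0 by split; [rewrite in_itv/= lexx ler01|rewrite subrr normr0 mulr0].
have A1 : ubound A 1 by move=> t [+ _]; rewrite in_itv/= => /andP[].
have hA : has_sup A by split; [exists 0|exists 1].
have ubA : has_ubound A by exists 1.
set s := sup A.
have s01 : s \in `[0, 1].
  by rewrite in_itv/= (ub_le_sup ubA A0)/= ge_sup//; exists 0.
have /nbhs_ballP[e /= e0 He] := H _ s01.
have As : A s.
  split=> //; have [t At st] := sup_adherent e0 hA.
  have ts : t <= s by exact: ub_le_sup.
  have : ball s e t.
    by rewrite /ball/= ger0_norm ?subr_ge0//; rewrite -/s in st; lra.
  move=> /He/=; rewrite distrC (@ler0_norm _ (t - s)) ?subr_le0// => h1.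
  have [_ h2] := At.
  have -> : phi s - phi 0 = (phi s - phi t) + (phi t - phi 0) by ring.
  by rewrite (le_trans (ler_normD _ _))//; lra.
have [s1|s1] := ltP s 1; last first.
  have s1' : s = 1 by move: s01 s1; rewrite in_itv/= => /andP[_ ? ?]; lra.
  by case: As; rewrite s1' mulr1.
(* A step short enough to stay in the ball where the estimate centred at [s] holds and to stay
   inside [[0, 1]]. *)
pose d := Num.min (e / 2) (1 - s).
have d0 : 0 < d by rewrite lt_min divr_gt0//= subr_gt0.
have de : d < e by rewrite gt_min; apply/orP; left; lra.
have d1 : d <= 1 - s by rewrite ge_min lexx orbT.
suff : A (s + d) by move/(ub_le_sup ubA); rewrite -/s; lra.
split.
  by move: s01; rewrite !in_itv/= => /andP[? ?]; apply/andP; split; lra.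
have : ball s e (s + d) by rewrite /ball/= opprD addrA subrr sub0r normrN gtr0_norm.
move=> /He/=; rewrite addrAC subrr add0r (gtr0_norm d0) => h1.
case: As => _ h2.
have -> : phi (s + d) - phi 0 = (phi (s + d) - phi s) + (phi s - phi 0) by ring.
by rewrite (le_trans (ler_normD _ _))//; lra.
Qed.

(** * Functions selected from finitely many smooth pieces over a closed cover *)

Section selection.
Context {R : realType} {m J : nat}.
Implicit Types (f h : 'rV[R]_m -> R) (E : 'I_J -> set 'rV[R]_m).
Implicit Types (g : 'I_J -> 'rV[R]_m -> R).

Definition C1_fun h := (forall x, differentiable h x) /\ continuous (gradient h).

(** The sets may overlap or be empty, which lets the same notion serve for the closures of the
    pieces and for the closures of the interiors of those. *)
Definition closed_selection f E g :=
  [/\ forall j, closed (E j), forall x, exists j, E j x &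
      forall j x, E j x -> f x = g j x].

Definition active_gradients E g x : set 'rV[R]_m :=
  [set u | exists2 j, E j x & u = gradient (g j) x].

Lemma is_C_C1_fun p h : p <> Some 0%N -> is_C p h -> C1_fun h.
Proof.
have Cn n : is_Cn n.+1 h -> C1_fun h.
  move=> [dh ch]; split=> // x; apply: (@cvg_row _ _ _ (nbhs x)) => i.
  rewrite mxE; under eq_cvg do rewrite mxE.
  case: n ch => [|n] /(_ i); first exact.
  by move=> [+ _] => /(_ x)/differentiable_continuous.
case: p => [[//|n] _|_ /(_ 1%N)]; exact: Cn.
Qed.

(** The complements of the finitely many closed sets missing [x] have a common neighborhood of [x]:
    no new piece becomes active nearby. *)
Lemma closed_near_active E x : (forall j, closed (E j)) ->
  \forall z \near x, forall j, E j z -> E j x.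
Proof.
move=> Ecl; apply: (@filter_forall _ _ _ (nbhs x)) => j.
have [Ejx|NEjx] := pselect (E j x); first by apply: nearW => z.
have : nbhs x (~` E j) by apply: open_nbhs_nbhs; split=> //; exact/closed_openC.
by apply: filterS => z NEz /NEz.
Qed.

Lemma gradients_locally_bounded g (x : 'rV[R]_m) : (forall j, C1_fun (g j)) ->
  exists2 M, 0 <= M & \forall z \near x, forall j, `|gradient (g j) z| <= M.
Proof.
move=> gC; exists (\sum_j `|gradient (g j) x| + 1).
  by rewrite addr_ge0// sumr_ge0.
apply: (@filter_forall _ _ _ (nbhs x)) => j.
have [_ /(_ x)/cvgrPdist_le/(_ 1 ltr01)] := gC j.
apply: filterS => z; rewrite distrC => zx.
rewrite -[gradient _ z](subrK (gradient (g j) x)) (le_trans (ler_normD _ _))//.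
by rewrite addrC lerD// (bigD1 j)//= lerDl sumr_ge0.
Qed.

(** A piece carrying [f] at [s] near [z] is also active at [z], so increments of [f] from [z] are
    increments of some [g j]. These pointwise bounds share one constant on a ball and integrate
    along its segments. *)
Lemma selection_locally_lipschitz f E g : closed_selection f E g ->
  (forall j, C1_fun (g j)) -> locally_lipschitz f.
Proof.
move=> [Ecl Ecov fE] gC x.
have [M M0 /nbhs_ballP[r /= r0 rM]] := gradients_locally_bounded x gC.
exists (ball x r); first exact: nbhsx_ballx.
have ? : ProperFilter (globally (ball x r `*` ball x r)).
  by apply: (@globally_properfilter _ _ (x, x)); split; exact: ballxx.
apply: (@klipschitzW _ _ _ (m%:R * M + 1)).
have loc z : ball x r z ->
    \forall s \near z, `|f s - f z| <= (m%:R * M + 1) * `|s - z|.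
  move=> zr.
  have : \forall s \near z, forall j,
      `|g j s - g j z| <= (m%:R * M + 1) * `|s - z|.
    apply: (@filter_forall _ _ _ (nbhs z)) => j; apply: differentiable_dist_le.
      by have [+ _] := gC j.
    by rewrite ler_wpM2l//; exact: rM.
  apply: filterS2 (closed_near_active z Ecl) => s Esz gs.
  by have [j Ejs] := Ecov s; rewrite (fE j)// (fE j z)//; exact: Esz.
move=> [y z] [/= yr zr].
pose phi t := f (z + t *: (y - z)).
have -> : f y - f z = phi 1 - phi 0.
  by rewrite /phi scale1r scale0r addr0 [z + _]addrC subrK.
rewrite (le_trans (@locally_dist_le_segment _ phi ((m%:R * M + 1) * `|y - z|) _))//.
move=> t; rewrite in_itv/= => /andP[t0 t1].
have cl : {for t, continuous (fun s : R => z + s *: (y - z))}.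
  by apply: cvgD; [exact: cvg_cst|apply: cvgZr_tmp; exact: cvg_id].
have /loc H : ball x r (z + t *: (y - z)).
  move: yr zr; rewrite -!ball_normE/= => yr zr.
  have -> : x - (z + t *: (y - z)) = t *: (x - y) + (1 - t) *: (x - z).
    rewrite scalerBl scale1r !scalerBr opprD !opprB.
    by apply/rowP => i; rewrite !mxE; ring.
  rewrite (le_lt_trans (ler_normD _ _))// !normrZ ger0_norm// ger0_norm ?subr_ge0//.
  (* The strict bound survives multiplication by [t] only for [t > 0]. *)
  have [->|t0'] := eqVneq t 0; first by rewrite mul0r add0r subr0 mul1r.
  have : t * `|x - y| < t * r by rewrite ltr_pM2l// lt_neqAle eq_sym t0'.
  have : (1 - t) * `|x - z| <= (1 - t) * r by rewrite ler_wpM2l ?subr_ge0// ltW.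
  lra.
have := cl _ H; apply: (@filterS _ (nbhs t)) => s /= h.
apply: le_trans h _; rewrite opprD addrACA subrr add0r -scalerBl normrZ.
by rewrite mulrA mulrAC.
Qed.

(** With a nonzero derivative the difference quotients would be nonzero near [t], making [t] an
    isolated zero. *)
Lemma derive1_eq0_limit_point (d : R -> R) t : derivable d t 1 ->
  d t = 0 -> limit_point [set s | d s = 0] t -> derive1 d t = 0.
Proof.
move=> dd dt0 lt; apply/eqP/negPn/negP => N0.
have := dd; rewrite /derivable; set q := (X in cvg (X @ _)) => dq.
have := cvgr_neq0 _ dq; rewrite -[lim _]/('D_1 d t) -derive1E => /(_ _ N0).
move=> /nbhs_ballP[e /= e0 He].
have [s [st ds0 ts]] := lt _ (nbhsx_ballx t e e0).
have /He : ball 0 e (s - t).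
  by move: ts; rewrite -ball_normE/= sub0r opprB.
rewrite subr_eq0 => /(_ st) /=; rewrite /q/= [_%:A]mulr1 subrK.
by rewrite ds0 dt0 subr0 scaler0 eqxx.
Qed.

Lemma chain_rule_at f E g (v : R -> 'rV[R]_m) t :
  closed_selection f E g -> (forall j, C1_fun (g j)) -> derivable v t 1 ->
  (forall j k, ~ isolated [set s | E j (v s) /\ E k (v s)] t) ->
  derivable (f \o v) t 1 /\
  forall u, active_gradients E g (v t) u ->
    derive1 (f \o v) t = dot (derive1 v t) u.
Proof.
move=> [Ecl Ecov fE] gC dv niso.
have gv j := derive1_comp_gradient dv ((gC j).1 (v t)).
pose c j := derive1 (g j \o v) t.
(* The time [t] is in the set where both pieces are active and is not isolated there, so it is a
   limit point of zeros of the difference of the two compositions. *)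
have ceq j k : E j (v t) -> E k (v t) -> c j = c k.
  move=> Ej Ek; apply/eqP; rewrite -subr_eq0; apply/eqP.
  have [[dj _] [dk _]] := (gv j, gv k).
  have -> : c j - c k = derive1 ((g j \o v) - (g k \o v)) t.
    by rewrite !derive1E deriveB// -!derive1E.
  apply: derive1_eq0_limit_point; first exact: derivableB.
    by rewrite !fctE/= -(fE j)// -(fE k)// subrr.
  have : closure [set s | E j (v s) /\ E k (v s)] t.
    by apply: subset_closure; split.
  rewrite closure_isolated_limit_point => -[/niso//|lp] U /lp[s [st [Ejs Eks] Us]].
  by exists s; split=> //=; rewrite !fctE/= -(fE j)// -(fE k)// subrr.
have [j0 Ej0] := Ecov (v t).
have vc : {for t, continuous v}.
  by apply: differentiable_continuous; exact/derivable1_diffP.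
(* For small [h] the quotient of [f \o v] is that of some [g j \o v] with [j] active at [t]. The
   piece may change with [h], but all active limits agree and finitely many estimates hold at
   once. *)
have quot : h^-1 *: ((f \o v) (h%:A + t) - (f \o v) t) @[h --> 0^'] --> c j0.
  apply/cvgrPdist_le => e e0.
  have H1 : \forall h \near 0^', forall j, E j (v (h%:A + t)) -> E j (v t).
    have : \forall s \near t, forall j, E j (v s) -> E j (v t).
      exact: vc _ (closed_near_active (v t) Ecl).
    rewrite (near_shift 0) subr0 => H; apply: nbhs_dnbhs.
    by apply: filterS H => h /=; rewrite [h%:A]mulr1.
  have H2 : \forall h \near 0^', forall j,
      `|c j - h^-1 *: ((g j \o v) (h%:A + t) - (g j \o v) t)| <= e.
    apply: filter_forall => j; have [dj _] := gv j.
    by have /cvgrPdist_le/(_ e e0) := dj; rewrite -[lim _]/('D_1 _ t) -derive1E.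
  apply: filterS2 H1 H2 => h H1 H2.
  have [j Ejh] := Ecov (v (h%:A + t)); have Ejt := H1 _ Ejh.
  by rewrite (ceq _ _ Ej0 Ejt)/= (fE j)// (fE j (v t))//; exact: H2.
split; first by apply/cvg_ex; exists (c j0).
move=> u [j Ejt ->].
have -> : derive1 (f \o v) t = c j0.
  by rewrite derive1E; apply/cvg_lim.
by rewrite (ceq _ _ Ej0 Ejt) /c (gv j).2.
Qed.

(** Isolated points of any set of reals are countable, hence form a measurable null set. *)
Lemma ae_not_isolated (S : set R) :
  {ae (@lebesgue_measure R), forall t, ~ isolated S t}.
Proof.
exists (isolated S); split.
- apply: countable_measurable; last exact: countable_isolated.
  by move=> t; exact: measurable_set1.
- by rewrite countable_lebesgue_measure0//; exact: countable_isolated.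
- by move=> t /= /contrapT.
Qed.

Lemma ae_neq (a : R) : {ae (@lebesgue_measure R), forall t, t <> a}.
Proof.
exists [set a]; split; [exact: measurable_set1|exact: lebesgue_measure_set1|].
by move=> t /= /contrapT.
Qed.

Lemma selection_chain_rule f E g : closed_selection f E g ->
  (forall j, C1_fun (g j)) -> chain_rule f (active_gradients E g).
Proof.
(* Lipschitz continuity is stated as validity of all constants beyond some [k], hence [k + 1]. *)
move=> sel gC v [k [_ /(_ (k + 1))]]; rewrite ltrDl ltr01 => /(_ isT) kv.
have dv : {ae (@lebesgue_measure R), forall t (i : 'I_m), t \in `]0, 1[ ->
    derivable (fun s => v s ord0 i) t 1}.
  apply: filter_forall => i; apply: (@lipschitz_ae_derivable _ (k + 1)).
  move=> [x y] /= xy; apply: le_trans (kv (x, y) xy).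
  by apply: le_trans (coord_le_norm _ i); rewrite !mxE.
have iso : {ae (@lebesgue_measure R), forall t (jk : 'I_J * 'I_J),
    ~ isolated [set s | E jk.1 (v s) /\ E jk.2 (v s)] t}.
  by apply: filter_forall => jk; exact: ae_not_isolated.
have aeF := ae_filter_ringOfSetsType (@lebesgue_measure R).
have n01 : {ae (@lebesgue_measure R), forall t : R, t <> 0 /\ t <> 1}.
  by apply: (@filterS2 _ _ aeF _ _ _ _ (ae_neq 0) (ae_neq 1)) => t.
apply: (@filterS3 _ _ aeF _ _ _ _ _ dv iso n01) => t {}dv {}iso [t0 t1].
rewrite in_itv/= => /andP[t0' t1'].
have t01 : t \in `]0, 1[.
  rewrite in_itv/= !lt_neqAle t0' t1' !andbT eq_sym.
  by apply/andP; split; apply/eqP.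
have dvt : derivable v t 1.
  by apply/derivable_mxP => i j; rewrite ord1; exact: dv.
have [? ?] := chain_rule_at sel gC dvt (fun j k => iso (j, k)).
by split.
Qed.

End selection.

(** * Convex combinations and convex hulls *)

Lemma convex_setP (R : realType) (m : nat) (C : set 'rV[R]_m) :
  convex_set C <-> forall t x y, 0 <= t <= 1 -> C x -> C y ->
    C (t *: x + (1 - t) *: y).
Proof.
split=> [Cc t x y /andP[t0 t1] Cx Cy|Cc x y l].
  by have := Cc x y (Itv01 t0 t1); rewrite !inE; exact.
by rewrite !inE => Cx Cy; apply: Cc => //; rewrite ge0 le1.
Qed.

(** Induction splits off the first weight and rescales the others by their sum [s]. Points of weight
    zero may lie outside [C], so a vanishing first weight or a vanishing [s] is treated apart. *)
Lemma convex_set_sum (R : realType) (m n : nat) (C : set 'rV[R]_m)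
    (l : 'I_n -> R) (a : 'I_n -> 'rV[R]_m) :
  convex_set C -> (forall j, 0 <= l j) -> \sum_j l j = 1 ->
  (forall j, l j != 0 -> C (a j)) -> C (\sum_j l j *: a j).
Proof.
move=> /convex_setP Cc; elim: n l a => [|n IHn] l a l0.
  by rewrite big_ord0 => /eqP; rewrite eq_sym oner_eq0.
rewrite !big_ord_recl; set s := \sum_(j < n) _ => l1 Ca.
have s0 : 0 <= s by exact: sumr_ge0.
have [l00|l00] := eqVneq (l ord0) 0.
  rewrite l00 scale0r add0r; move: l1; rewrite l00 add0r => l1.
  by apply: IHn => // j; exact: Ca.
have [s00|s00] := eqVneq s 0.
  have lr j : l (lift ord0 j) = 0.
    apply/eqP; move/eqP: s00; rewrite psumr_eq0//.
    by move=> /allP/(_ j (mem_index_enum _)).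
  rewrite big1 => [|j _]; last by rewrite lr scale0r.
  by move: l1; rewrite s00 !addr0 => ->; rewrite scale1r; apply: Ca.
have -> : \sum_(j < n) l (lift ord0 j) *: a (lift ord0 j) =
    (1 - l ord0) *: \sum_(j < n) (s^-1 * l (lift ord0 j)) *: a (lift ord0 j).
  rewrite scaler_sumr; apply: eq_bigr => j _; rewrite scalerA mulrA.
  by rewrite -l1 [l _ + _]addrC addrK divff// mul1r.
apply: Cc; [|exact: Ca|apply: IHn => [j||j]].
- by rewrite l0 -l1 lerDl.
- by rewrite mulr_ge0// invr_ge0.
- by rewrite -mulr_sumr mulVf.
- by rewrite mulf_eq0 negb_or => /andP[_]; exact: Ca.
Qed.

Lemma closed_near (T : topologicalType) (A : set T) :
  (forall z, ~ A z -> \forall y \near z, ~ A y) -> closed A.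
Proof. by move=> H z; apply: contraPP => /H nA /(_ _ nA)[y [Ay /(_ Ay)]]. Qed.

Lemma near_notin_fst (T U : topologicalType) (A : set T) (x : T) (u : U) :
  closed A -> ~ A x -> \forall z \near (x, u), ~ A z.1.
Proof.
move=> Acl NAx; exists (~` A, setT) => [|[y w] []//].
split; last exact: filterT.
by apply: open_nbhs_nbhs; split=> //; exact/closed_openC.
Qed.

Section conv.
Context {R : realType} {m : nat}.
Implicit Types (A B : set 'rV[R]_m) (D : 'rV[R]_m -> set 'rV[R]_m).

Lemma sub_conv A : A `<=` conv A.
Proof. exact: sub_smallest. Qed.

Lemma conv_sub A B : convex_set B -> A `<=` B -> conv A `<=` B.
Proof. exact: smallest_sub. Qed.

Lemma convex_conv A : convex_set (conv A).
Proof.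
apply/convex_setP => t x y t01 Ax Ay B [Bc AB].
move/convex_setP: (Bc); apply => //; [exact: Ax|exact: Ay].
Qed.

Lemma convex_norm_le (M : R) : convex_set [set u : 'rV[R]_m | `|u| <= M].
Proof.
apply/convex_setP => t x y /andP[t0 t1] /= xM yM.
rewrite (le_trans (ler_normD _ _))// !normrZ ger0_norm// ger0_norm ?subr_ge0//.
have : t * `|x| <= t * M by rewrite ler_wpM2l.
have : (1 - t) * `|y| <= (1 - t) * M by rewrite ler_wpM2l ?subr_ge0.
lra.
Qed.

Lemma locally_bounded_norm_le D :
  (forall x : 'rV[R]_m, exists M,
    \forall z \near x, forall u, D z u -> `|u| <= M) ->
  locally_bounded D.
Proof.
move=> DM x; have [M xM] := DM x.
exists [set z | forall u, D z u -> `|u| <= M]; first exact: xM.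
exists M; split; first exact: num_real.
by move=> N MN u [z zM Dzu]; apply: le_trans (zM _ Dzu) _; exact: ltW.
Qed.

(** At a fixed time, the vectors [u] satisfying the derivative identity form a convex set, so the
    same null set works for the hull. *)
Lemma chain_rule_conv f D : chain_rule f D -> chain_rule f (fun x => conv (D x)).
Proof.
move=> fD v /fD; apply: (@filterS _ _ (ae_filter_ringOfSetsType _)) => t H /H.
case=> dv dfv Du; split=> // u; move: u; apply: conv_sub; last exact: Du.
apply/convex_setP => a x y _ /= vx vy.
by rewrite dotDr !dotZr -vx -vy; ring.
Qed.

End conv.

(** * Active gradients and their convex hulls as conservative fields *)

Section active_gradients.
Context {R : realType} {m J : nat}.
Implicit Types (E : 'I_J -> set 'rV[R]_m) (g : 'I_J -> 'rV[R]_m -> R).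

(** The graph is a finite union of graphs of the continuous maps [gradient (g j)] over the closed
    sets [E j]. *)
Lemma active_gradients_graph_closed E g : (forall j, closed (E j)) ->
  (forall j, C1_fun (g j)) -> graph_closed (active_gradients E g).
Proof.
move=> Ecl gC; apply: closed_near => -[x u] /= Nxu.
have : \forall z \near (x, u), forall j, ~ (E j z.1 /\ z.2 = gradient (g j) z.1).
  apply: (@filter_forall _ _ _ (nbhs (x, u))) => j.
  have [Ejx|NEjx] := pselect (E j x).
    have ux : u - gradient (g j) x != 0.
      by apply/eqP => /subr0_eq uE; apply: Nxu; exists j.
    have : (fun z : 'rV[R]_m * 'rV[R]_m => z.2 - gradient (g j) z.1) @ (x, u) -->
        u - gradient (g j) x.
      apply: cvgB; first exact: cvg_snd.
      by apply: (@cvg_comp _ _ _ fst (gradient (g j)) _ (nbhs x));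
        [exact: cvg_fst|exact: (gC j).2].
    move=> /cvgr_neq0 /(_ ux); apply: (@filterS _ (nbhs (x, u))) => z /= zn [_ zE].
    by move: zn; rewrite zE subrr eqxx.
  have := @near_notin_fst _ _ _ x u (Ecl j) NEjx.
  by apply: (@filterS _ (nbhs (x, u))) => z Nz [].
by apply: (@filterS _ (nbhs (x, u))) => z Nz [j Ej zE]; exact: (Nz j).
Qed.

(** Weights are indexed by the pieces, with activity imposed where they are nonzero, so that one
    simplex serves for every [x]. *)
Lemma conv_active_gradients E g x : conv (active_gradients E g x) =
  [set u | exists l : 'rV[R]_J, [/\ forall j, 0 <= l ord0 j,
     \sum_j l ord0 j = 1, forall j, l ord0 j != 0 -> E j x &
     u = \sum_j l ord0 j *: gradient (g j) x]].
Proof.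
apply/seteqP; split=> [|_ [l [l0 l1 lE ->]]]; last first.
  apply: convex_set_sum => //; first exact: convex_conv.
  by move=> j /lE Ej; apply: sub_conv; exists j.
apply: conv_sub => [|_ [j Ej ->]]; last first.
  exists (delta_mx ord0 j); split=> [k|||].
  - by rewrite mxE ler0n.
  - rewrite (bigD1 j)//= mxE !eqxx big1 ?addr0// => k kj.
    by rewrite mxE (negbTE kj) andbF.
  - by move=> k; rewrite mxE eqxx/=; have [->//|] := eqVneq k j; rewrite eqxx.
  - rewrite (bigD1 j)//= mxE !eqxx scale1r big1 ?addr0// => k kj.
    by rewrite mxE (negbTE kj) andbF scale0r.
apply/convex_setP => t _ _ /andP[t0 t1] [l [l0 l1 lE ->]] [k [k0 k1 kE ->]].
exists (t *: l + (1 - t) *: k); split=> [j|||].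
- by rewrite !mxE addr_ge0// mulr_ge0// subr_ge0.
- under eq_bigr do rewrite !mxE.
  by rewrite big_split/= -!mulr_sumr l1 k1; ring.
- move=> j; rewrite !mxE => H.
  have [lj|] := eqVneq (l ord0 j) 0; last exact: lE.
  by apply: kE; apply: contraNneq H => ->; rewrite lj !mulr0 addr0.
- rewrite !scaler_sumr -big_split; apply: eq_bigr => j _ /=.
  by rewrite !mxE !scalerA -scalerDl.
Qed.

Lemma compact_simplex :
  compact [set l : 'rV[R]_J | (forall j, 0 <= l ord0 j) /\ \sum_j l ord0 j = 1].
Proof.
apply: bounded_closed_compact.
  exists 1; split; first exact: num_real.
  move=> M M1 l [l0 l1]; apply: le_trans (ltW M1).
  rewrite [leLHS]/Num.Def.normr/= mx_normrE; apply: bigmax_le => // -[i j] _ /=.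
  by rewrite (ord1 i) ger0_norm// -l1 (bigD1 j)//= lerDl sumr_ge0.
apply: closedI.
  apply: closed_near => l /existsNP[j /negP]; rewrite -ltNge => lj.
  have := cvgr_lt _ (@coord_continuous _ _ _ ord0 j l) _ lj.
  move=> /(_ (nbhs_filter l)); apply: (@filterS _ (nbhs l)) => k kj /(_ j).
  by rewrite leNgt kj.
apply: closed_near => l /eqP; rewrite -subr_eq0 => l1.
have : (fun l : 'rV[R]_J => \sum_j l ord0 j - 1) @ l --> \sum_j l ord0 j - 1.
  apply: (@cvgB _ R^o _ (nbhs l)); last exact: cvg_cst.
  by apply: (@cvg_bigsum _ R^o _ _ (nbhs l)) => j; exact: coord_continuous.
move=> /cvgr_neq0 /(_ l1); apply: (@filterS _ (nbhs l)) => k kn k1.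
by move: kn; rewrite k1 subrr eqxx.
Qed.

Lemma conv_active_gradients_graph_closed E g : (forall j, closed (E j)) ->
  (forall j, C1_fun (g j)) ->
  graph_closed (fun x => conv (active_gradients E g x)).
Proof.
move=> Ecl gC; apply: closed_near => -[x u] /= Nxu.
have := compact_simplex; rewrite compact_near_coveringP.
(* [P z l] says that the weights [l] fail to represent [z.2] at [z.1]. This failure is open jointly
   in [z] and [l], and compactness of the simplex yields one neighborhood of [(x, u)] for all
   [l]. *)
pose P (z : 'rV[R]_m * 'rV[R]_m) (l : 'rV[R]_J) :=
  ~ ((forall j, l ord0 j != 0 -> E j z.1) /\
     z.2 = \sum_j l ord0 j *: gradient (g j) z.1).
move=> /(_ _ (nbhs (x, u)) P _) H.
have : \forall z \near (x, u), [set l : 'rV[R]_J | (forall j, 0 <= l ord0 j) /\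
    \sum_j l ord0 j = 1] `<=` P z.
  apply: H => l [l0 l1].
  have : P (x, u) l.
    by move=> [lE uE]; apply: Nxu; rewrite conv_active_gradients; exists l.
  move=> /not_andP[/existsNP[j /not_implyP[lj NEj]]|/eqP].
    have H1 : nbhs l [set k : 'rV[R]_J | k ord0 j != 0].
      exact: cvgr_neq0 (@coord_continuous _ _ _ ord0 j l) lj.
    have H2 := @near_notin_fst _ _ _ x u (Ecl j) NEj.
    exists ([set k : 'rV[R]_J | k ord0 j != 0], [set z | ~ E j z.1]).
      by split.
    by move=> [k z] /= [kj NEz] [/(_ j kj)].
  rewrite -subr_eq0 => ul.
  have : (fun kz : 'rV[R]_J * ('rV[R]_m * 'rV[R]_m) =>
      kz.2.2 - \sum_j kz.1 ord0 j *: gradient (g j) kz.2.1) @ (l, (x, u)) -->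
      u - \sum_j l ord0 j *: gradient (g j) x.
    have c2 : (fun kz : 'rV[R]_J * ('rV[R]_m * 'rV[R]_m) => kz.2.2)
        @ (l, (x, u)) --> u.
      by apply: (@cvg_comp _ _ _ snd snd _ (nbhs (x, u))); exact: cvg_snd.
    have c1 : (fun kz : 'rV[R]_J * ('rV[R]_m * 'rV[R]_m) => kz.2.1)
        @ (l, (x, u)) --> x.
      by apply: (@cvg_comp _ _ _ snd fst _ (nbhs (x, u)));
        [exact: cvg_snd|exact: cvg_fst].
    apply: cvgB => //; apply: (@cvg_bigsum _ _ _ _ (nbhs (l, (x, u)))) => j.
    apply: cvgZ; last by apply: cvg_comp c1 _; exact: (gC j).2.
    apply: (@cvg_comp _ _ _ fst (fun k : 'rV[R]_J => k ord0 j) _ (nbhs l)).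
      exact: cvg_fst.
    exact: coord_continuous.
  move=> /cvgr_neq0 /(_ ul).
  apply: (@filterS _ (nbhs (l, (x, u)))) => -[k z] /= kz [_ zE].
  by move: kz; rewrite zE subrr eqxx.
apply: (@filterS _ (nbhs (x, u))) => z Pz; rewrite conv_active_gradients.
by move=> [l [l0 l1 lE zE]]; apply: (Pz l).
Qed.

Lemma active_gradients_conservative f E g : closed_selection f E g ->
  (forall j, C1_fun (g j)) -> conservative_field f (active_gradients E g).
Proof.
move=> sel gC; have [Ecl Ecov _] := sel; split.
- apply: locally_bounded_norm_le => x.
  have [M _ xM] := gradients_locally_bounded x gC; exists M.
  by apply: (@filterS _ (nbhs x)) xM => z zM u [j _ ->]; exact: zM.
- exact: active_gradients_graph_closed.
- by move=> x; have [j Ej] := Ecov x; exists (gradient (g j) x), j.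
- exact: selection_chain_rule.
Qed.

Lemma conv_active_gradients_conservative f E g : closed_selection f E g ->
  (forall j, C1_fun (g j)) ->
  conservative_field f (fun x => conv (active_gradients E g x)).
Proof.
move=> sel gC; have [Ecl Ecov _] := sel; split.
- apply: locally_bounded_norm_le => x.
  have [M _ xM] := gradients_locally_bounded x gC; exists M.
  apply: (@filterS _ (nbhs x)) xM => z zM.
  by apply: conv_sub; [exact: convex_norm_le|move=> u [j _ ->]; exact: zM].
- exact: conv_active_gradients_graph_closed.
- move=> x; have [j Ej] := Ecov x; exists (gradient (g j) x).
  by apply: sub_conv; exists j.
- by apply: chain_rule_conv; exact: selection_chain_rule.
Qed.

End active_gradients.

(** * The Clarke subdifferential and the cover by closures of interiors *)

(** A finite Baire argument: either [U] lies in the first closed set, or removing that set leaves a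
    nonempty open set covered by the others. *)
Lemma open_closed_cover_interior (T : topologicalType) (I : eqType) (s : seq I)
    (C : I -> set T) (U : set T) :
  (forall i, closed (C i)) -> open U -> U !=set0 ->
  (forall x, U x -> exists2 i, i \in s & C i x) ->
  exists2 i, i \in s & (U `&` interior (C i)) !=set0.
Proof.
move=> Ccl; elim: s U => [|i s IHs] U Uo [x Ux] Ucov; first by have [] := Ucov x Ux.
have [UC|] := pselect (U `<=` C i).
  exists i; first exact: mem_head.
  by exists x; split=> //; apply: filterS UC _; exact: open_nbhs_nbhs.
move=> /existsNP[y /not_implyP[Uy NCy]].
have [|||k ks [z [[Uz _] Cz]]] := IHs (U `&` ~` C i).
- by apply: openI => //; exact: closed_openC.
- by exists y.
- move=> z [/Ucov[k]]; rewrite inE => /orP[/eqP ->//|ks Ckz _].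
  by exists k.
by exists k; [rewrite inE ks orbT|exists z].
Qed.

Lemma closure_seq (R : realType) (m : nat) (A : set 'rV[R]_m) x :
  closure A x ->
  exists2 xs : nat -> 'rV[R]_m, forall n, A (xs n) & xs n @[n --> \oo] --> x.
Proof.
move=> Ax.
have /choice[xs xsP] n : exists y, A y /\ ball x n.+1%:R^-1 y.
  have [|y []] := Ax (ball x n.+1%:R^-1); last by exists y.
  by apply: nbhsx_ballx; rewrite invr_gt0.
exists xs; first by move=> n; have [] := xsP n.
apply/cvgrPdist_lt => e e0.
have /cvgrPdist_lt/(_ e e0) := @cvg_harmonic R.
apply: filterS => n; rewrite sub0r normrN ger0_norm ?harmonic_ge0// => ne.
have [_] := xsP n; rewrite -ball_normE/= => /lt_trans; exact.
Qed.

(** The first-order expansion of [h] at [x] is also one of [f], and such an expansion with a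
    continuous linear part determines the differential. *)
Lemma near_eq_differentiable (R : realType) (V W : normedModType R)
    (f h : V -> W) (x : V) :
  (\forall z \near x, f z = h z) -> differentiable h x -> differentiable f x.
Proof.
move=> fh dh.
have fE : f \o shift x = cst (f x) + 'd h x +o_ 0 id.
  apply/eqaddoP => e e0.
  have /diff_locally/eqaddoP/(_ e e0) := dh.
  move: (fh); rewrite (near_shift 0) subr0 => fh0.
  apply: (@filterS2 _ (nbhs (0 : V)) _ _ _ _ _ fh0) => z /= fz.
  by rewrite !fctE /= fz (nbhs_singleton fh).
have dhc := diff_continuous dh.
by apply/diff_locallyP; rewrite (diff_unique dhc fE).
Qed.

Section clarke.
Context {R : realType} {m J : nat}.
Implicit Types (f : 'rV[R]_m -> R) (E : 'I_J -> set 'rV[R]_m).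
Implicit Types (g : 'I_J -> 'rV[R]_m -> R).

(* Along each direction [f] coincides infinitely often with an active piece, so
   the hyperplanes orthogonal to [gradient f x - gradient (g j) x], [j] active,
   cover the space; one of them has interior, hence is the whole space. *)
Lemma gradient_active f E g x : closed_selection f E g ->
  (forall j, C1_fun (g j)) -> differentiable f x ->
  active_gradients E g x (gradient f x).
Proof.
move=> [Ecl Ecov fE] gC df.
pose w j := gradient f x - gradient (g j) x.
(* Inactive pieces give the empty set, so an index found with nonempty interior is automatically
   active. *)
pose C j := [set d | E j x /\ dot d (w j) = 0].
have Ccl j : closed (C j).
  have [Ej|NEj] := pselect (E j x); last first.
    rewrite (_ : C j = set0); first exact: closed0.
    by apply/seteqP; split=> // d [].
  apply: closed_near => d Nd.
  have d0 : dot d (w j) != 0 by apply/eqP => d0; apply: Nd.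
  have /cvgr_neq0/(_ d0) := @continuous_dot _ _ (w j) d.
  by apply: (@filterS _ (nbhs d)) => z /eqP z0 [].
(* Otherwise, for small nonzero [s], the increment of [f] along [d] would differ from that of every
   active piece, although one of them carries [f] at [s *: d + x]. *)
have Ccov d : exists j, C j d.
  apply: contrapT => /forallNP NC.
  have quot h : differentiable h x ->
      s^-1 *: (h (s *: d + x) - h x) @[s --> (0 : R)^'] --> dot d (gradient h x).
    move=> dh; rewrite -diff_dot_gradient// -deriveE//.
    exact: diff_derivable dh.
  have H1 : \forall s \near (0 : R)^', forall j, E j (s *: d + x) -> E j x.
    have cl : {for (0 : R), continuous (fun s : R => s *: d + x)}.
      by apply: cvgD; [apply: cvgZr_tmp; exact: cvg_id|exact: cvg_cst].
    have : nbhs ((0 : R) *: d + x) [set z | forall j, E j z -> E j x].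
      by rewrite scale0r add0r; exact: closed_near_active.
    by move=> /cl; exact: nbhs_dnbhs.
  have H2 : \forall s \near (0 : R)^', forall j, E j x ->
      f (s *: d + x) - f x != g j (s *: d + x) - g j x.
    apply: (@filter_forall _ _ _ (0 : R)^') => j.
    have [Ej|NEj] := pselect (E j x); last by apply: nearW.
    have d0 : dot d (gradient f x) - dot d (gradient (g j) x) != 0.
      by rewrite -dotBr; apply/eqP => d0; apply: (NC j).
    have qc := cvgB (quot _ df) (quot _ ((gC j).1 x)).
    have F0 : Filter (0 : R)^' by exact: _.
    have := @cvgr_neq0 _ _ _ _ F0 _ _ (qc F0) d0.
    apply: (@filterS _ (0 : R)^') => s sn _.
    by apply: contraNneq sn => sE; rewrite !fctE/= sE subrr.
  have [s [s1 s2]] := filter_ex (filterI H1 H2).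
  have [j Ejs] := Ecov (s *: d + x).
  by have := s2 j (s1 _ Ejs); rewrite (fE j)// (fE j x) ?eqxx//; exact: s1.
have [|d _|j _ [d [_ /nbhs_ballP[e /= e0 eC]]]] :=
    @open_closed_cover_interior _ _ (enum 'I_J) C setT Ccl openT.
- by exists 0.
- by have [j Cj] := Ccov d; exists j => //; rewrite mem_enum.
have [Ej dw] := eC _ (ballxx d e0).
exists j => //; apply/eqP; rewrite -subr_eq0 -/(w j); apply/eqP/rowP => i.
(* Moving within the ball along the [i]-th axis keeps the dot product zero, which forces the [i]-th
   coordinate of [w j] to vanish. *)
have [|_] := eC (d + (e / 2) *: delta_mx ord0 i).
  split=> // i' k; rewrite ord1 !mxE eqxx/=.
  rewrite /ball/= opprD addrA subrr sub0r normrN.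
  case: eqP => _; last by rewrite mulr0 normr0.
  by rewrite mulr1 gtr0_norm ?divr_gt0//; lra.
rewrite dotDl dw add0r dotZl dot_delta => /eqP.
by rewrite mulf_eq0 gt_eqF ?divr_gt0//= => /eqP ->; rewrite mxE.
Qed.

(** Points missed by all the new sets form an open set; were it nonempty, the interior of some [E j]
    would meet it, which is absurd. *)
Lemma closed_selection_regular f E g : closed_selection f E g ->
  closed_selection f (fun j => closure (interior (E j))) g.
Proof.
move=> [Ecl Ecov fE].
have sub j : closure (interior (E j)) `<=` E j.
  by apply: subset_trans (Ecl j); apply: closure_subset; exact: interior_subset.
split; [by move=> j; exact: closed_closure| |by move=> j x /sub; exact: fE].
move=> x; apply: contrapT => /forallNP Nx.
pose U := interior [set z | forall j, ~ closure (interior (E j)) z].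
have Ux : U x.
  apply: (@filter_forall _ _ _ (nbhs x)) => j.
  by apply: open_nbhs_nbhs; split; [exact/closed_openC/closed_closure|exact: Nx].
have [|z _|j _ [z [Uz Ez]]] :=
    @open_closed_cover_interior _ _ (enum 'I_J) E U Ecl (open_interior _).
- by exists x.
- by have [j Ej] := Ecov z; exists j => //; rewrite mem_enum.
by apply: (interior_subset Uz) (subset_closure Ez).
Qed.

(** For one inclusion, gradients of [f] are active for the regularized cover, whose graph is closed.
    For the other, [f] and [g j] have equal gradients in the interior of [E j], and these converge
    by continuity. *)
Lemma limiting_gradients_active f E g : closed_selection f E g ->
  (forall j, C1_fun (g j)) ->
  limiting_gradients f =
  active_gradients (fun j => closure (interior (E j))) g.
Proof.
move=> sel gC; have rsel := closed_selection_regular sel.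
have [Ecl _ fE] := sel.
apply/funext => x; apply/seteqP; split=> [u [xs [dxs xsx gu]]|_ [j Ejx ->]].
  have cl := active_gradients_graph_closed
    (fun j => @closed_closure _ (interior (E j))) gC.
  apply: (@closed_cvg _ _ \oo _ (fun n => (xs n, gradient f (xs n))) _ cl _ (x, u)).
    by apply: nearW => n /=; exact: gradient_active.
  exact: (cvg_pair xsx gu).
have [xs xsE xsx] := closure_seq Ejx.
have fg n : \forall z \near xs n, f z = g j z.
  by have := xsE n; apply: (@filterS _ (nbhs (xs n))) => z; exact: fE.
exists xs; split=> // [n|].
  by apply: near_eq_differentiable (fg n) _; exact: (gC j).1.
have -> : (fun n => gradient f (xs n)) = gradient (g j) \o xs.
  apply/funext => n; apply/rowP => i; rewrite !mxE; exact: near_eq_derive.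
by apply: cvg_comp xsx _; exact: (gC j).2.
Qed.

End clarke.

Theorem theorem3p2 (R : realType) (m : nat) (hm : (0 < m)%N)
    (p : option nat) (hp : p <> Some 0%N)
    (f : 'rV[R]_m -> R) (hf : piecewise_C p f)
    (J : nat) (P : 'I_J -> set 'rV[R]_m) (g : 'I_J -> 'rV[R]_m -> R)
    (hrep : representation p f P g) :
  [/\ conservative_field f (piece_field P g),
      path_differentiable f,
      conservative_field f (fun x => conv (piece_field P g x)) &
      conservative_field f (clarke f)].
Proof.
have [[_ _ _ Pcov] gCp fP] := hrep; have [fc _] := hf.
have gC j : C1_fun (g j) := is_C_C1_fun hp (gCp j).
have sel : closed_selection f (fun j => closure (P j)) g.
  split=> [j|x|j x]; first exact: closed_closure.
    have : (\bigcup_j P j) x by rewrite Pcov.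
    by case=> j _ Pjx; exists j; exact: subset_closure.
  (* By continuity, agreement of [f] with [g j] extends from [P j] to its closure. *)
  have cE : closed [set z | f z - g j z = 0].
    apply: closed_near => z /eqP z0.
    have : (fun y => f y - g j y) @ z --> f z - g j z.
      apply: (@cvgB _ R^o _ (nbhs z)); first exact: fc.
      exact/differentiable_continuous/(gC j).1.
    move=> /cvgr_neq0/(_ z0); apply: (@filterS _ (nbhs z)) => y /eqP y0.
    exact: y0.
  move=> /(closure_subset (B := [set z | f z - g j z = 0])) Pjx.
  by apply/subr0_eq/cE/Pjx => z /fP /= ->; rewrite subrr.
(* [piece_field P g] unfolds to the active gradients of the cover by closures. *)
have fD := active_gradients_conservative sel gC.
split.
- exact: fD.
- split; last by exists (piece_field P g); exact: fD.
  exact: selection_locally_lipschitz sel gC.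
- exact: conv_active_gradients_conservative sel gC.
- have := conv_active_gradients_conservative (closed_selection_regular sel) gC.
  by rewrite /clarke (limiting_gradients_active sel gC).
Qed.
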